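(* Let $G$ be a countable, finitely generated amenable group and let $A$ be a finite set. The entropy map $h\colon\mathfrak{S}\to[0,\infty)$ on the space $\mathfrak{S}$ of shifts in $A^G$ is upper semi-continuous.
   Context: $A^G$ carries the product topology ($A$ discrete), and $G$ acts on it by $[gx](h)=x(g^{-1}h)$. A shift is a nonempty closed $G$-invariant subset $X\subseteq A^G$. For finite $K\subset G$, $x_K$ is the restriction of $x$ to $K$ and $X_K=\{x_K : x\in X\}$. The space $\mathfrak{S}$ of all shifts in $A^G$ has the Hausdorff topology, which is compact and Polish; $X^n\to X$ if and only if for every finite $K\subset G$ one has $X^n_K=X_K$ for all large enough $n$. Fix a left-invariant word metric $d$ on $G$, and let $B_r=\{g\in G: d(e,g)\le r\}$. For finite nonempty $F\subset G$ let $\partial_rF=\{g\in G: gB_r\cap F\ne\emptyset \text{ and } gB_r\cap(G\setminus F)\neq\emptyset\}$ and $\rho_r(F)=|\partial_rF|/|F|$. A sequence $(F_n)$ of finite nonempty subsets of $G$ is Følner if $\lim_n\rho_r(F_n)=0$ for every $r\in\mathbb{N}$. The entropy of a shift $X$ is $h(X)=\lim_{n\to\infty}\frac{1}{|F_n|}\log|X_{F_n}|$ for any Følner sequence $(F_n)$ (the limit exists and does not depend on the sequence). *)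

(* Defs.v *)
From HB Require Import structures.
From mathcomp Require Import all_boot all_order all_algebra finmap.
From mathcomp Require Import all_classical all_reals all_analysis.

Set Implicit Arguments.
Unset Strict Implicit.
Unset Printing Implicit Defensive.

Import Order.TTheory GRing.Theory Num.Theory.
Import numFieldNormedType.Exports.

Local Open Scope classical_set_scope.
Local Open Scope ring_scope.

Section word_metric.
Context {G : groupType} (S : {fset G}).

Definition is_word (n : nat) (g : G) : Prop := exists s : seq G,
  [/\ size s = n, all (fun x => (x \in S) || (x^-1%g \in S)) s
    & g = (\prod_(x <- s) x)%g].

Definition generates : Prop := forall g, exists n, is_word n g.

(* The default value 0 is never used when S generates G. *)
Definition word_length (g : G) : nat :=
  xget 0%N [set n | is_word n g /\ forall m, is_word m g -> (n <= m)%N].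

Definition word_dist (g h : G) : nat := word_length (g^-1 * h)%g.

Definition word_ball (r : nat) : set G :=
  [set g | (word_dist 1%g g <= r)%N].

Definition boundary (r : nat) (F : {fset G}) : set G :=
  [set g | [set (g * b)%g | b in word_ball r] `&` [set` F] !=set0 /\
           [set (g * b)%g | b in word_ball r] `&` ~` [set` F] !=set0].

(* [fset_set] turns the boundary, which is a finite set, into an {fset G}. *)
Definition boundary_ratio (R : realType) (r : nat) (F : {fset G}) : R :=
  #|` fset_set (boundary r F)|%:R / #|` F|%:R.

Definition folner (R : realType) (F : nat -> {fset G}) : Prop :=
  (forall n, F n != fset0) /\
  (forall r : nat, (fun n => boundary_ratio R r (F n)) @ \oo --> (0 : R)).

(* Amenability of the group generated by S, in terms of Folner sequences; it
   does not depend on the choice of the finite generating set S, nor on R. *)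
Definition amenable (R : realType) : Prop := exists F, folner R F.

End word_metric.

(* The topology of A^G is the product of the discrete topologies; it carries
   the product of the discrete uniformities, which is its only uniformity as A
   is finite. *)
Notation configuration G A := {ptws G -> discrete_topology A}.

Definition translate {G : groupType} {A : finType} (g : G)
  (x : configuration G A) : configuration G A := fun h => x (g^-1 * h)%g.

Record shift_space (G : groupType) (A : finType) := Shift {
  shift_set :> set (configuration G A);
  shift_neq0 : shift_set !=set0;
  shift_closed : closed shift_set;
  shift_invariant : forall g x, shift_set x -> shift_set (translate g x)
}.

HB.instance Definition _ (G : groupType) (A : finType) :=
  gen_eqMixin (shift_space G A).
HB.instance Definition _ (G : groupType) (A : finType) :=
  gen_choiceMixin (shift_space G A).

(* X and Y are E-close for the Hausdorff uniformity: each is contained in the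
   E-neighbourhood of the other. When E is {(x, y) | d(x, y) < e} for a metric
   d, this expresses (on compact sets) that the Hausdorff distance is < e. *)
Definition hausdorff_close {T : Type} (E : set (T * T)) (X Y : set T) : Prop :=
  (forall x, X x -> exists2 y, Y y & E (x, y)) /\
  (forall y, Y y -> exists2 x, X x & E (x, y)).

Section hausdorff_uniformity.
Context (G : groupType) (A : finType).
Local Open Scope relation_scope.

Definition shift_ent : set_system (shift_space G A * shift_space G A) :=
  filter_from (@entourage (configuration G A))
    (fun E => [set XY : shift_space G A * shift_space G A |
               hausdorff_close E XY.1 XY.2]).

Local Lemma shift_ent_filter : Filter shift_ent.
Proof.
apply: filter_from_filter; first by exists setT; exact: filterT.
move=> E F entE entF; exists (E `&` F); first exact: filterI.
move=> [X Y] /= [XY YX]; split; split => z /[dup] Zz.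
- by move=> /XY[y Yy []]; exists y.
- by move=> /YX[y Yy []]; exists y.
- by move=> /XY[y Yy []]; exists y.
- by move=> /YX[y Yy []]; exists y.
Qed.

Local Lemma shift_ent_diag D : shift_ent D -> diagonal `<=` D.
Proof.
move=> [E entE ED] [X Y] /= XY; apply: ED; rewrite /diagonal /= in XY.
by rewrite XY; split => x Xx /=; exists x => //; exact: entourage_refl.
Qed.

Local Lemma shift_ent_inv D : shift_ent D -> shift_ent D^-1.
Proof.
move=> [E entE ED]; exists E^-1; first exact: entourage_inv.
by move=> [X Y] /= [XY YX]; apply: ED; split.
Qed.

Local Lemma shift_ent_split D :
  shift_ent D -> exists2 C, shift_ent C & C \; C `<=` D.
Proof.
move=> [E entE ED]; have [F entF FE] := entourage_split_ex entE.
exists [set XY : shift_space G A * shift_space G A | hausdorff_close F XY.1 XY.2].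
  by exists F.
move=> [X Y] [Z /= [XZ ZX] [ZY YZ]]; apply: ED; split => z /=.
- by move=> /XZ[u /ZY[v Yv Fuv] Fzu]; exists v => //; apply: FE; exists u.
- by move=> /YZ[u /ZX[v Yv Fuv] Fzu]; exists v => //; apply: FE; exists u.
Qed.

HB.instance Definition _ := isUniform.Build (shift_space G A)
  shift_ent_filter shift_ent_diag shift_ent_inv shift_ent_split.

End hausdorff_uniformity.

Section patterns.
Context {G : groupType} {A : finType}.

Definition restriction (K : {fset G}) (x : configuration G A) : {ffun K -> A} :=
  [ffun k : K => x (val k)].

Definition patterns (K : {fset G}) (X : set (configuration G A)) :
  {set {ffun K -> A}} := [set w | w \in (restriction K @` X)%classic]%SET.

End patterns.

Lemma patternsP (G : groupType) (A : finType) (K : {fset G}) (X : set (configuration G A)) w :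
  reflect (exists2 x, X x & restriction K x = w) (w \in patterns K X).
Proof. rewrite inE; apply: (iffP idP) => [/set_mem//|h]; exact/mem_set. Qed.

Lemma entourage_configuration (G : groupType) (A : finType) (E : set (configuration G A * configuration G A)) :
  entourage E <-> exists K : {fset G},
    [set xy : configuration G A * configuration G A | forall k, k \in K -> xy.1 k = xy.2 k] `<=` E.
Proof.
split.
  move=> [_ [D _ <-] DE]. 
  pose K := ((fun p => (sval p).1 : G) @` [set` D]).
  have finK : finite_set K by apply: finite_image; exact: finite_fset.
  exists (fset_set K) => -[x y] /= xy; apply: DE => p /= pD.
  have := svalP p; rewrite /in_mem/= => /asboolP /= [V entV VE].
  have xyp : x (sval p).1 = y (sval p).1.
    by apply: xy; rewrite in_fset_set//; apply/mem_set; exists p.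
  apply: VE; change (V (x (sval p).1, y (sval p).1)); rewrite xyp; exact: entourage_refl.
move=> [K KE].
have FF : Filter (@entourage (configuration G A)) by exact: entourage_filter.
apply: (filterS KE); move: {E KE} K.
elim/finSet_rect => K IH.
have [->|/fset0Pn[k kK]] := eqVneq K fset0.
  by apply: filterS filterT.
have := IH _ (fproperD1 kK).
have : entourage [set xy : configuration G A * configuration G A | xy.1 k = xy.2 k].
  pose V : set (discrete_topology A * discrete_topology A) := [set ab | ab.1 = ab.2].
  have entV : entourage V by rewrite uniform_discrete => _ [a _ <-].
  pose I : choiceType := {classic G}.
  pose W : set (configuration G A * configuration G A) := [set xy | xy.1 k = xy.2 k].
  pose TS (i : G) : uniformType := initial_topology (@proj G (fun _ => discrete_topology A) i).
  have entW : `[< @entourage (TS k) W >].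
    by apply/asboolP; exists V.
  pose p := exist (fun p : I * set (configuration G A * configuration G A) => `[< @entourage (TS p.1) p.2 >]) (k, W) entW.
  exists (\bigcap_(q in [set` [fset p]%fset]) (sval q).2).
    by exists [fset p]%fset => // q _; exact: in_setT.
  by move=> xy h; have := h p (fset11 p).
move=> entk entK'; apply: filterS (filterI entk entK') => -[x y] /= [xyk xyK'] h.
by have [->//|hk hK] := eqVneq h k; apply: xyK'; rewrite !inE hk.
Qed.

Lemma patterns_hausdorff (G : groupType) (A : finType) (K : {fset G})
    (X Y : set (configuration G A)) :
  patterns K X = patterns K Y <->
  hausdorff_close [set xy : configuration G A * configuration G A |
    forall k, k \in K -> xy.1 k = xy.2 k] X Y.
Proof.
have rE (x y : configuration G A) : restriction K x = restriction K y <-> forall k, k \in K -> x k = y k.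
  split=> [/ffunP xy k kK|xy]; last by apply/ffunP => k; rewrite !ffunE xy ?fsvalP.
  by have := xy [` kK]%fset; rewrite !ffunE.
split=> [XY|[XY YX]].
  split=> [x Xx|y Yy].
    have /patternsP[y Yy /rE yx] : restriction K x \in patterns K Y by rewrite -XY; apply/patternsP; exists x.
    by exists y => // k /yx.
  have /patternsP[x Xx /rE xy] : restriction K y \in patterns K X by rewrite XY; apply/patternsP; exists y.
  by exists x => // k /xy.
apply/setP => w; apply/patternsP/patternsP => -[z Zz <-].
  by have [y Yy /rE] := XY _ Zz; exists y.
by have [x Xx /rE] := YX _ Zz; exists x.
Qed.

Lemma nbhs_shiftP (G : groupType) (A : finType) (X : shift_space G A) (P : set (shift_space G A)) :
  nbhs X P <-> exists K : {fset G}, [set Y : shift_space G A | patterns K Y = patterns K X] `<=` P.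
Proof.
rewrite -nbhs_entourageE; split.
  move=> [D [E /entourage_configuration[K KE] ED] DP].
  exists K => Y /= /esym/patterns_hausdorff[XY YX]; apply/DP/xsectionP/ED; split.
    by move=> x /XY[y Yy xy]; exists y => //; exact: KE.
  by move=> y /YX[x Xx xy]; exists x => //; exact: KE.
move=> [K KP].
pose E := [set xy : configuration G A * configuration G A |
    forall k, k \in K -> xy.1 k = xy.2 k].
exists [set XY : shift_space G A * shift_space G A | hausdorff_close E XY.1 XY.2].
  by exists E => //; apply/entourage_configuration; exists K.
by move=> Y /xsectionP /= /patterns_hausdorff XY; exact: KP.
Qed.

(* When G is countable, the topology is metrizable and hence determined by this
   criterion. *)
Lemma cvg_shiftP (G : groupType) (A : finType) (X : nat -> shift_space G A) (Y : shift_space G A) :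
  (X n @[n --> \oo] --> Y) <-> forall K : {fset G}, \forall n \near \oo, patterns K (X n) = patterns K Y.
Proof.
split=> [XY K|XY P /nbhs_shiftP[K KP]]; last by near=> n; apply: KP => /=; near: n; exact: XY.
by apply: (XY [set Z : shift_space G A | patterns K Z = patterns K Y]); apply/nbhs_shiftP; exists K.
Unshelve. all: by end_near. Qed.

Section entropy.
Context {G : groupType} {A : finType} (R : realType) (S : {fset G}).

Definition is_entropy (X : shift_space G A) (l : R) : Prop :=
  forall F : nat -> {fset G}, folner S R F ->
    (fun n => ln (#|patterns (F n) X|%:R : R) / #|` F n|%:R) @ \oo --> l.

(* When S generates G and G is amenable, there is exactly one l such that
   is_entropy X l, by the Ornstein-Weiss lemma, and l >= 0. *)
Definition entropy (X : shift_space G A) : R := get (is_entropy X).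

End entropy.

Definition upper_semicontinuous {T : topologicalType} {R : numDomainType}
  (f : T -> R) : Prop :=
  forall x a, f x < a -> \forall y \near x, f y < a.

(* Main.v *)
(* For a shift X and a finite nonempty K, put q(K) = log |X_K| / |K|. Shearer's
   inequality, applied to all translates gK that meet F (each point of F lies in
   exactly |K| of them), gives q(F) <= q(K) + rho_r(F) log |A| whenever K is
   contained in B_r. Hence h(X) = inf_K q(K) along every Folner sequence, which
   proves at once the existence of the limit and the upper semi-continuity: if
   q(K) < a for X, then q(K) < a for every shift with the same K-patterns. *)
Require Import Defs.
From mathcomp Require Import all_boot all_order all_algebra finmap.
From mathcomp Require Import all_classical all_reals all_analysis.
From mathcomp Require Import ring.

Set Implicit Arguments.
Unset Strict Implicit.
Unset Printing Implicit Defensive.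

Import Order.TTheory GRing.Theory Num.Theory.
Import numFieldNormedType.Exports.

Local Open Scope classical_set_scope.
Local Open Scope ring_scope.

(** * Hölder's inequality for finite sums *)

(* Hoelder's inequality without roots: were it to fail, the hypothesis divided
   by [(\sum_a m a) ^+ #|J|] and AM-GM would give [m a / \sum_a m a] strictly
   below the mean of the [n j a / \sum_a n j a], and both sum to 1 over [a]. *)
Lemma holder_sum (F : realFieldType) (I A : finType) (J : {pred I})
    (c : F) (m : A -> F) (n : I -> A -> F) :
  (0 < #|J|)%N -> 0 <= c -> (forall a, 0 <= m a) -> (forall j a, 0 <= n j a) ->
  (forall a, m a ^+ #|J| <= c * \prod_(j in J) n j a) ->
  (\sum_a m a) ^+ #|J| <= c * \prod_(j in J) \sum_a n j a.
Proof.
move=> k0 c0 m0 n0 mn; set k := #|J| in k0 mn *.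
pose M := \sum_a m a; pose N j := \sum_a n j a.
have N0 j : 0 <= N j by exact: sumr_ge0.
have M0 : 0 <= M by exact: sumr_ge0.
rewrite leNgt; apply/negP => cNM.
have Mk0 : 0 < M ^+ k by apply: le_lt_trans cNM; rewrite mulr_ge0 //; apply: prodr_ge0 => j _; exact: N0.
have {}M0 : 0 < M.
  rewrite lt_neqAle M0 andbT eq_sym; apply: contraTneq Mk0 => ->.
  by rewrite expr0n eqn0Ngt k0 ltxx.
(* A vanishing factor [n j a] would force [m a ^+ k <= 0]. *)
have n_gt0 a j : 0 < m a -> j \in J -> 0 < n j a.
  move=> ma jJ; rewrite lt_neqAle n0 andbT eq_sym.
  have : m a ^+ k != 0 by rewrite expf_neq0 // gt_eqF.
  apply: contraNneq => nja; rewrite eq_le exprn_ge0 // andbT.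
  by rewrite (le_trans (mn a)) // (bigD1 j) //= nja mul0r mulr0.
have [a0 ma0] : exists a, 0 < m a.
  have /eqP : M != 0 by rewrite gt_eqF.
  by move/(psumr_neq0P (fun a _ => m0 a)) => [a ma]; exists a.
have N_gt0 j : j \in J -> 0 < N j.
  move=> jJ; rewrite /N (bigD1 a0) //= ltr_pwDl ?sumr_ge0 //.
  exact: n_gt0.
pose mu a := (\sum_(j in J) n j a / N j) / k%:R.
have mu0 a : 0 <= mu a.
  by rewrite divr_ge0 // sumr_ge0 // => j _; rewrite divr_ge0.
have m_lt a : 0 < m a -> m a < M * mu a.
  move=> ma; rewrite -(@ltr_pXn2r _ k) ?nnegrE ?(mulr_ge0 (ltW M0) (mu0 a)) //.
  apply: le_lt_trans (mn a) _; rewrite exprMn.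
  have -> : c * \prod_(j in J) n j a =
      c * \prod_(j in J) N j * \prod_(j in J) (n j a / N j).
    rewrite -mulrA -big_split /=; congr (_ * _); apply: eq_bigr => j jJ.
    by rewrite mulrC divfK // gt_eqF ?N_gt0.
  (* Strictness comes from [cNM], the assumed failure; AM-GM then gives the non-strict half. *)
  apply: (@lt_le_trans _ _ (M ^+ k * \prod_(j in J) (n j a / N j))).
    rewrite ltr_pM2r //; apply: prodr_gt0 => j jJ.
    by rewrite divr_gt0 ?N_gt0 ?n_gt0.
  rewrite ler_pM2l //; have [] // := @leif_AGM F I J (fun j => n j a / N j).
  by move=> j _; rewrite divr_ge0.
have m_le a : m a <= M * mu a.
  have := m0 a; rewrite le_eqVlt => /predU1P[<-|/m_lt/ltW //].
  by rewrite mulr_ge0 // ltW.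
have mu1 : \sum_a mu a = 1.
  rewrite -mulr_suml exchange_big /=.
  rewrite (eq_bigr (fun=> 1)) => [|j jJ]; last first.
    by rewrite -mulr_suml divff // gt_eqF ?N_gt0.
  by rewrite sumr_const divff // pnatr_eq0 -lt0n.
suff : M < M by rewrite ltxx.
rewrite -[ltRHS]mulr1 -mu1 mulr_sumr {1}/M (bigD1 a0) //= [ltRHS](bigD1 a0) //=.
by rewrite ltr_leD ?m_lt // ler_sum.
Qed.

Lemma holder_sumn (I A : finType) (J : {pred I})
    (c : nat) (m : A -> nat) (n : I -> A -> nat) : (0 < #|J|)%N ->
  (forall a, m a ^ #|J| <= c * \prod_(j in J) n j a)%N ->
  ((\sum_a m a) ^ #|J| <= c * \prod_(j in J) \sum_a n j a)%N.
Proof.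
move=> k0 mn; rewrite -(ler_nat rat) natrX natrM natr_prod natr_sum.
under [in leRHS]eq_bigr do rewrite natr_sum.
apply: holder_sum => // a.
by rewrite -natrX -natr_prod -natrM ler_nat.
Qed.

(** * Pattern counts and Shearer's inequality *)

Lemma patternsS (G : groupType) (A : finType) (K : {fset G})
    (X Y : set (configuration G A)) :
  X `<=` Y -> patterns K X \subset patterns K Y.
Proof.
move=> XY; apply/fintype.subsetP => w /patternsP[x /XY Yx <-].
by apply/patternsP; exists x.
Qed.

Lemma card_patterns_gt0 (G : groupType) (A : finType) (K : {fset G})
    (X : set (configuration G A)) : X !=set0 -> (0 < #|patterns K X|)%N.
Proof.
by move=> [x Xx]; apply/card_gt0P; exists (restriction K x); apply/patternsP; exists x.
Qed.

Lemma card_patterns_le (G : groupType) (A : finType) (K : {fset G})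
    (X : set (configuration G A)) : (#|patterns K X| <= #|A| ^ #|` K|)%N.
Proof. by rewrite (leq_trans (max_card _)) // card_ffun cardfE. Qed.

(** Among patterns with value [a] at [v], forgetting [v] is injective. [X] is any set of
    configurations because slices of a shift are not invariant. *)
Lemma card_patterns_slice (G : groupType) (A : finType) (K : {fset G}) (v : G)
    (X : set (configuration G A)) : v \in K ->
  #|patterns K X| =
    (\sum_(a : A) #|patterns (K `\ v)%fset (X `&` [set x | x v = a])|)%N.
Proof.
move=> vK.
rewrite -sum1_card (partition_big (fun w : {ffun K -> A} => w [` vK]%fset) xpredT) //=.
apply: eq_bigr => a _; rewrite sum1_card.
have sub : {subset (K `\ v)%fset <= K} by move=> k /fsetD1P[].
pose f (w : {ffun K -> A}) : {ffun (K `\ v)%fset -> A} :=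
  [ffun k => w [` sub _ (valP k)]%fset].
have fE x : f (restriction K x) = restriction (K `\ v)%fset x.
  by apply/ffunP => k; rewrite !ffunE.
rewrite -(@card_in_image _ _ f) => [|w1 w2].
  apply: eq_card => u; apply/fintype.imageP/patternsP => [[w]|[x [Xx xa] <-]].
    rewrite unfold_in => /andP[/patternsP[x Xx <-] /eqP]; rewrite ffunE /= => xa ->.
    by exists x => //; rewrite fE.
  exists (restriction K x); rewrite ?fE // unfold_in ffunE /= xa eqxx andbT.
  by apply/patternsP; exists x.
rewrite !unfold_in => /andP[_ /eqP w1a] /andP[_ /eqP w2a] /ffunP w12.
apply/ffunP => -[k kK]; have [kv|kv] := eqVneq k v.
  by subst k; rewrite (bool_irrelevance kK vK) w1a w2a.
have kKv : k \in (K `\ v)%fset by rewrite !inE kv.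
by have := w12 [` kKv]%fset; rewrite !ffunE /=; rewrite (bool_irrelevance (sub _ _) kK).
Qed.

(* Induction on F: slice at a point v of F, and recombine the slices by Hoelder. *)
Lemma shearer (G : groupType) (A J : finType) (E : J -> {fset G}) (k : nat)
    (F : {fset G}) (X : set (configuration G A)) : (0 < k)%N ->
  (forall v, v \in F -> #|[pred j | v \in E j]| = k) ->
  (#|patterns F X| ^ k <= \prod_j #|patterns (E j `&` F)%fset X|)%N.
Proof.
move=> k0; elim/finSet_rect: F X => F IH X Ek.
(* For empty [F] there is at most one pattern. If [X] is empty too, the left side is 0 since
   [k > 0]; otherwise every factor on the right is positive. *)
have [F0|/fset0Pn[v vF]] := eqVneq F fset0.
  have [->|/set0P X0] := eqVneq X set0.
    rewrite (_ : patterns F set0 = finset.set0) ?cards0 ?exp0n //.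
    by apply/setP => w; rewrite finset.in_set0; apply/patternsP => -[].
  apply: (@leq_trans 1).
    have := card_patterns_le F X; rewrite F0 cardfs0 expn0 => h.
    by rewrite -(exp1n k) leq_exp2r.
  by apply: prodn_gt0 => j; exact: card_patterns_gt0.
rewrite (card_patterns_slice _ vF).
(* Exactly [k] indices satisfy [v \in E j]; they form the index set for Hölder. The other factors do
   not depend on the value at [v] and make up the constant [c]. *)
rewrite (bigID (fun j => v \in E j)) /= mulnC -{1}(Ek v vF).
under [X in (_ <= _ * X)%N]eq_bigr => j vEj.
  rewrite (@card_patterns_slice _ _ _ v); last by rewrite inE vEj.
  over.
apply: holder_sumn => [|a]; first by rewrite Ek.
rewrite Ek //; apply: leq_trans (IH _ (fproperD1 vF) _ _) _.
  by move=> u /fsetD1P[_ /Ek].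
rewrite (bigID (fun j => v \in E j)) /= mulnC leq_mul //.
  (* If [E j] misses [v], removing [v] from [F] changes nothing, and a slice has no more patterns
     than [X]. *)
  apply: leq_prod => j vEj.
  rewrite (_ : (E j `&` (F `\ v) = E j `&` F)%fset); last first.
    apply/fsetP => u; rewrite !inE; have [->|//] := eqVneq u v.
    by rewrite (negbTE vEj).
  by apply: subset_leq_card; apply: patternsS => x [].
by apply: leq_prod => j vEj; rewrite fsetIDA.
Qed.

(** Translating by the inverse of [g] keeps a configuration in [X] and moves its pattern on [gK] to
    [K]. *)
Lemma card_patterns_translate (G : groupType) (A : finType) (X : shift_space G A)
    (g : G) (K : {fset G}) :
  (#|patterns [fset (g * k)%g | k in K]%fset X| <= #|patterns K X|)%N.
Proof.
set gK := [fset _ | _ in _]%fset.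
have gkP (k : K) : (g * val k)%g \in gK.
  by apply/imfsetP; exists (val k) => //; exact: valP.
pose f (w : {ffun gK -> A}) : {ffun K -> A} := [ffun k => w [` gkP k]%fset].
rewrite -(@card_in_image _ _ f) => [|w1 w2 _ _ /ffunP w12].
  apply: subset_leq_card; apply/fintype.subsetP => u /fintype.imageP[w].
  move=> /patternsP[x Xx <-] ->; apply/patternsP.
  exists (translate g^-1%g x); first exact: shift_invariant.
  by apply/ffunP => k; rewrite !ffunE /translate invgK.
apply/ffunP => -[h hgK]; have /imfsetP[k /= kK hE] := hgK.
have := w12 [` kK]%fset; rewrite !ffunE; subst h.
by rewrite (bool_irrelevance (gkP [` kK]%fset) hgK).
Qed.

Lemma card_leq_fset (T : finType) (G : choiceType) (P : {pred T}) (f : T -> G)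
    (B : {fset G}) :
  injective f -> (forall j, j \in P -> f j \in B) -> (#|P| <= #|` B|)%N.
Proof.
move=> fI PB; rewrite cardE -(size_map f); apply: uniq_leq_size.
  by rewrite map_inj_uniq // enum_uniq.
by move=> x /mapP[j]; rewrite mem_enum => /PB ? ->.
Qed.

(** * Finiteness of word balls and boundaries *)

Lemma word_lengthP (G : groupType) (S : {fset G}) (g : G) :
  generates S -> is_word S (word_length S g) g.
Proof.
move=> /(_ g)[n0 gn0]; rewrite /word_length.
have [|//] := @xgetPex nat 0%N
  [set n | is_word S n g /\ forall m, is_word S m g -> (n <= m)%N].
have ex : exists n, `[< is_word S n g >] by exists n0; exact/asboolP.
exists (ex_minn ex); case: ex_minnP => n /asboolP gn nmin.
by split=> // m gm; apply: nmin; apply/asboolP.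
Qed.

Lemma finite_words (G : groupType) (S : {fset G}) (n : nat) :
  finite_set [set g | is_word S n g].
Proof.
pose S' : {fset G} := (S `|` [fset x^-1%g | x in S])%fset.
elim: n => [|n IH].
  apply: (sub_finite_set _ (finite_set1 1%g)) => _ [s [s0 _ ->]] /=.
  by rewrite (size0nil s0) big_nil.
apply: (sub_finite_set _ (finite_image2 (@monoid.mul G) (finite_fset S') IH)).
move=> _ [[|x s] [] //= [sn] /andP[xS sS] ->]; rewrite big_cons.
exists x; last by exists (\prod_(y <- s) y)%g => //; exists s.
rewrite /= in_fsetU; case/orP: xS => [->//|xS]; apply/orP; right.
by apply/imfsetP; exists x^-1%g => //=; rewrite invgK.
Qed.

Lemma finite_word_ball (G : groupType) (S : {fset G}) (r : nat) :
  generates S -> finite_set (word_ball S r).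
Proof.
move=> genS; apply: (@sub_finite_set _ _
    (\bigcup_(n in `I_r.+1) [set g | is_word S n g])).
  move=> g; rewrite /word_ball /word_dist /= invg1 mul1g => gr.
  by exists (word_length S g) => //=; exact: word_lengthP.
by apply: bigcup_finite => // n _; exact: finite_words.
Qed.

(** This makes [fset_set (boundary S r F)] the actual boundary: on an infinite set [fset_set] would
    return the empty set. *)
Lemma finite_boundary (G : groupType) (S : {fset G}) (r : nat) (F : {fset G}) :
  generates S -> finite_set (boundary S r F).
Proof.
move=> genS; apply: (sub_finite_set _ (finite_image2
  (fun f b : G => f * b^-1)%g (finite_fset F) (finite_word_ball r genS))).
move=> g [[_ [[b bB <-] gbF]] _] /=; exists (g * b)%g => //.
by exists b => //; rewrite mulgK.
Qed.

Lemma fset_sub_word_ball (G : groupType) (S : {fset G}) (K : {fset G}) :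
  exists r, forall k, k \in K -> word_ball S r k.
Proof.
exists (\max_(k <- K) word_dist S 1%g k)%N => k kK.
by rewrite /word_ball /=; apply: (leq_bigmax_seq (F := word_dist S 1%g)).
Qed.

(** * Covering by translates and the entropy formula *)

(* Shearer's inequality for the family of all translates of K that meet F: the
   translates inside F number at most |F|, the others are centered on the
   boundary. *)
Lemma card_patterns_leq (G : groupType) (A : finType) (S : {fset G})
    (X : shift_space G A) (r : nat) (K F : {fset G}) :
  generates S -> K != fset0 -> (forall k, k \in K -> word_ball S r k) ->
  (#|patterns F X| ^ #|` K| <=
   #|patterns K X| ^ #|` F| * (#|A| ^ #|` K|) ^ #|` fset_set (boundary S r F)|)%N.
Proof.
move=> genS K0 KB.
have [x0 Xx0] := shift_neq0 X.
have A0 : (0 < #|A|)%N by apply/card_gt0P; exists (x0 1%g).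
(* The translate [gK] meets [F] exactly when [g] has the form [f * k^-1]. *)
pose T := [fset (f * k^-1)%g | f in F, k in K]%fset.
pose E (j : T) := [fset (val j * k)%g | k in K]%fset.
have inE_ v j : (v \in E j) = (((val j)^-1 * v)%g \in K).
  apply/imfsetP/idP => [[k kK ->]|kK]; first by rewrite mulKg.
  by exists ((val j)^-1 * v)%g => //; rewrite mulVKg.
apply: leq_trans (@shearer _ A _ E _ F X _ _) _; first by rewrite cardfs_gt0.
  move=> v vF; have vT (k : K) : (v * (val k)^-1)%g \in T.
    by apply/imfset2P; exists v => //; exists (val k) => //; exact: valP.
  (* The translates containing [v] are those centered at [v * k^-1], one for each [k] in [K]. *)
  pose h (k : K) : T := [` vT k]%fset.
  rewrite [RHS]cardfE -(@card_imset _ _ h) => [|k1 k2]; last first.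
    by case=> /mulgI /invg_inj /val_inj.
  apply: eq_card => j; rewrite unfold_in /= inE_; apply/idP/imsetP => [jK|[k _ ->]].
    exists [` jK]%fset => //; apply/val_inj; rewrite /= invgM invgK.
    by rewrite mulgA mulgV mul1g.
  by rewrite /= invgM invgK mulgVK; exact: valP.
rewrite (bigID (fun j => E j `<=` F)%fset) /=; apply: leq_mul.
  apply: (@leq_trans (\prod_(j | (E j `<=` F)%fset) #|patterns K X|)%N).
    by apply: leq_prod => j /fsetIidPl ->; exact: card_patterns_translate.
  rewrite prod_nat_const leq_pexp2l //.
    by apply: card_patterns_gt0; exists x0.
  (* For one fixed [k], the map sending [j] to [j * k] injects the centers of translates inside [F]
     into [F]. *)
  have [k kK] := fset0Pn _ K0.
  apply: (@card_leq_fset _ _ _ (fun j => val j * k)%g) => [j1 j2|j].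
    by move=> /mulIg /val_inj.
  by move=> /fsubsetP; apply; apply/imfsetP; exists k.
apply: (@leq_trans (\prod_(j | ~~ (E j `<=` F)%fset) #|A| ^ #|` K|)%N).
  apply: leq_prod => j _; apply: leq_trans (card_patterns_le _ _) _.
  rewrite leq_pexp2l // (leq_trans (fsubset_leq_card (fsubsetIl _ _))) //.
  exact: leq_imfset_card.
rewrite prod_nat_const leq_pexp2l ?expn_gt0 ?A0 //.
apply: (@card_leq_fset _ _ _ val) => [|j jF]; first exact: val_inj.
rewrite in_fset_set; last exact: finite_boundary.
apply/mem_set; split.
  have /imfset2P[f fF [k kK jE]] := valP j.
  exists f; split=> //; exists k; first exact: KB.
  by rewrite jE mulgVK.
have /fsubsetPn[v /imfsetP[k kK ->] jkF] := jF.
exists (val j * k)%g; split; last exact/negP.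
by exists k => //; exact: KB.
Qed.

Definition pattern_rate (R : realType) (G : groupType) (A : finType)
    (X : shift_space G A) (K : {fset G}) : R :=
  ln #|patterns K X|%:R / #|` K|%:R.

Lemma pattern_rate_ge0 (R : realType) (G : groupType) (A : finType)
    (X : shift_space G A) (K : {fset G}) : 0 <= pattern_rate R X K.
Proof.
by rewrite divr_ge0 // ln_ge0 // ler1n card_patterns_gt0 //; exact: shift_neq0.
Qed.

Lemma pattern_rate_leq (R : realType) (G : groupType) (A : finType)
    (S : {fset G}) (X : shift_space G A) (r : nat) (K F : {fset G}) :
  generates S -> K != fset0 -> F != fset0 ->
  (forall k, k \in K -> word_ball S r k) ->
  pattern_rate R X F <=
    pattern_rate R X K + boundary_ratio S R r F * ln #|A|%:R.
Proof.
move=> genS K0 F0 KB.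
have [x0 Xx0] := shift_neq0 X.
have A0 : (0 < #|A|)%N by apply/card_gt0P; exists (x0 1%g).
have Kp : 0 < #|` K|%:R :> R by rewrite ltr0n cardfs_gt0.
have Fp : 0 < #|` F|%:R :> R by rewrite ltr0n cardfs_gt0.
have P0 L : (0 < #|patterns L X|)%N.
  by apply: card_patterns_gt0; exact: shift_neq0.
have h := card_patterns_leq X F genS K0 KB.
rewrite -(ler_nat R) natrM !natrX in h.
rewrite -ler_ln ?posrE ?mulr_gt0 ?exprn_gt0 ?ltr0n // in h.
rewrite lnM ?posrE ?exprn_gt0 ?ltr0n // !lnXn ?exprn_gt0 ?ltr0n // in h.
rewrite -[X in X <= _]mulr_natr -[X in _ <= X + _]mulr_natr in h.
rewrite -[X in _ <= _ + X]mulr_natr -[X in _ <= _ + X * _]mulr_natr in h.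
rewrite /pattern_rate /boundary_ratio.
have K0' := lt0r_neq0 Kp; have F0' := lt0r_neq0 Fp.
set f := ln _ in h *; set k := ln #|patterns K X|%:R in h *.
set a := ln _ in h *; set b : R := #|` fset_set _|%:R in h *.
set cF := #|` F|%:R in h Fp F0' *; set cK := #|` K|%:R in h Kp K0' *.
rewrite -subr_ge0 (_ : _ - _ = (k * cF + a * cK * b - f * cK) / (cK * cF)).
  by rewrite divr_ge0 ?subr_ge0 // mulr_ge0 // ltW.
by field; rewrite K0' F0'.
Qed.

Lemma is_entropy_inf (R : realType) (G : groupType) (A : finType)
    (S : {fset G}) (X : shift_space G A) : generates S ->
  is_entropy S X (inf [set pattern_rate R X K | K in [set K | K != fset0]]).
Proof.
move=> genS F [F0 Fr]; set E := [set _ | _ in _].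
have lbE : lbound E 0 by move=> _ [K _ <-]; exact: pattern_rate_ge0.
have infE : has_inf E.
  by split; [exists (pattern_rate R X (F 0%N)); exists (F 0%N) => //; exact: F0
            |exists 0].
change (pattern_rate R X (F n) @[n --> \oo] --> inf E).
apply/cvgrPdist_lt => e e0.
(* Half of [e] pays for the choice of [K], the other half for the boundary term, which tends to 0 as
   [K] and [r] stay fixed. *)
have [_ [K K0 <-] Ke] := inf_adherent (divr_gt0 e0 (ltr0Sn R 1)) infE.
have [r KB] := fset_sub_word_ball S K.
have : boundary_ratio S R r (F n) * ln #|A|%:R @[n --> \oo] --> (0 : R).
  by rewrite -[X in _ --> X](mul0r (ln #|A|%:R)); apply: cvgMl; exact: Fr.
move=> /cvgrPdist_lt /(_ _ (divr_gt0 e0 (ltr0Sn R 1))) Fe.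
near=> n.
have EF : inf E <= pattern_rate R X (F n).
  by apply: ge_inf infE.2 _ _; exists (F n) => //; exact: F0.
rewrite distrC ger0_norm ?subr_ge0 // ltrBlDl.
apply: le_lt_trans (pattern_rate_leq R X genS K0 (F0 n) KB) _.
rewrite (splitr e) addrA ltrD //.
apply: le_lt_trans (ler_norm _) _; rewrite -normrN -sub0r; near: n; exact: Fe.
Unshelve. all: by end_near. Qed.

(** [get] returns some limit value, since the infimum is one; a Følner sequence, supplied by
    amenability, makes that value unique. *)
Lemma entropyE (R : realType) (G : groupType) (A : finType)
    (S : {fset G}) (X : shift_space G A) : generates S -> amenable S R ->
  entropy R S X = inf [set pattern_rate R X K | K in [set K | K != fset0]].
Proof.
move=> genS [F folF]; have hX := is_entropy_inf (R := R) (X := X) genS.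
have := getI hX => /(_ F folF) h1.
exact: (norm_cvg_unique h1 (hX F folF)).
Qed.

Theorem proposition1p3 (R : realType) (G : groupType) (A : finType)
  (S : {fset G}) (countG : countable [set: G]%classic)
  (genS : generates S) (amenG : amenable S R) :
  upper_semicontinuous (entropy R S : shift_space G A -> R).
Proof.
move=> X a; rewrite entropyE // => /inf_lt[|_ [K K0 <-] Ka].
  (* [inf_lt] asks for a nonempty set of rates; a term of a Følner sequence provides a nonempty
     finite set. *)
  have [F [F0 _]] := amenG.
  by exists (pattern_rate R X (F 0%N)); exists (F 0%N) => //; exact: F0.
apply/nbhs_shiftP; exists K => Y /= YX; rewrite entropyE //.
apply: le_lt_trans Ka; rewrite /pattern_rate -YX; apply: ge_inf; last by exists K.
by exists 0 => _ [L _ <-]; exact: pattern_rate_ge0.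
Qed.
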